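(* For every instance of the packing disjoint bilinear program (defined in the context), the linear programs (RLT-PDB) and (LP-PDB) defined in the context are equivalent, in the sense that their optimal values coincide: $z_{\mathrm{RLT\text{-}PDB}}=z_{\mathrm{LP\text{-}PDB}}$.
   Context: Packing disjoint bilinear program: $\max\{\mathbf x^T\mathbf y\mid\mathbf x\in\mathcal X,\mathbf y\in\mathcal Y\}$ with $\mathcal X=\{\mathbf x\in\mathbb R^n\mid\mathbf x\ge\mathbf 0,\ \mathbf P\mathbf x\le\mathbf p\}$ and $\mathcal Y=\{\mathbf y\in\mathbb R^n\mid\mathbf y\ge\mathbf 0,\ \mathbf Q\mathbf y\le\mathbf q\}$, where $\mathbf P\in\mathbb R_+^{m_1\times n}$, $\mathbf Q\in\mathbb R_+^{m_2\times n}$, $\mathbf p\in\mathbb R_+^{m_1}$, $\mathbf q\in\mathbb R_+^{m_2}$; $\mathcal X,\mathcal Y$ are polytopes (bounded). Let $\theta_i=\max_{\mathbf x\in\mathcal X}x_i$, $\gamma_i=\max_{\mathbf y\in\mathcal Y}y_i$, and let $\mathbf P_i,\mathbf Q_i$ denote the $i$-th columns of $\mathbf P,\mathbf Q$. (LP-PDB): $$z_{\mathrm{LP\text{-}PDB}}=\max_{\boldsymbol\omega\ge\mathbf 0}\Big\{\sum_{i=1}^n\theta_i\gamma_i\omega_i\ \Big|\ \sum_{i=1}^n\theta_i\mathbf P_i\omega_i\le\mathbf p,\ \sum_{i=1}^n\gamma_i\mathbf Q_i\omega_i\le\mathbf q\Big\}.$$ (RLT-PDB), a reformulation-linearization relaxation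 of the (rescaled) bilinear program, with variables $\mathbf x,\mathbf y\in\mathbb R^n$ and $\mathbf u=(u_{ij})\in\mathbb R^{n\times n}$: $$z_{\mathrm{RLT\text{-}PDB}}=\max\ \sum_{i=1}^n\theta_i\gamma_iu_{ii}$$ subject to $\sum_i\theta_i\mathbf P_ix_i\le\mathbf p$; $\ \sum_i\theta_i\mathbf P_iu_{ij}\le\mathbf p\,y_j$ for all $j$; $\ \sum_i\gamma_i\mathbf Q_iy_i\le\mathbf q$; $\ \sum_i\gamma_i\mathbf Q_iu_{ji}\le\mathbf q\,x_j$ for all $j$; $\ 0\le x_i\le1$, $0\le y_i\le1$ for all $i$; $\ 0\le u_{ij}\le y_j$ and $0\le u_{ji}\le x_j$ for all $i,j$. *)

(* Defs.v *)
From HB Require Import structures.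
From mathcomp Require Import all_boot all_order all_algebra.
From mathcomp Require Import all_classical all_reals all_analysis.

Set Implicit Arguments.
Unset Strict Implicit.
Unset Printing Implicit Defensive.

Import Order.TTheory GRing.Theory Num.Theory.
Import numFieldNormedType.Exports.

Local Open Scope classical_set_scope.
Local Open Scope ring_scope.

Definition is_max (R : realType) (A : set R) (z : R) : Prop :=
  A z /\ ubound A z.

(* The maximum of A; the default 0 is returned only if A has no maximum. *)
Definition maxval (R : realType) (A : set R) : R := xget 0 (is_max A).

(* Entrywise order; MathComp's matrices carry no canonical order. *)
Definition lemx (R : realType) (m n : nat) (A B : 'M[R]_(m, n)) : Prop :=
  forall i j, A i j <= B i j.

Notation "A <=m B" := (lemx A B) (at level 70, no associativity) : ring_scope.

Section PackingBilinear.
Variables (R : realType) (n : nat).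

Definition packing_set (m : nat) (A : 'M[R]_(m, n)) (b : 'cV[R]_m) :
    set 'cV[R]_n :=
  [set x | 0 <=m x /\ A *m x <=m b].

(* theta_i = coord_max P p i, gamma_i = coord_max Q q i *)
Definition coord_max (m : nat) (A : 'M[R]_(m, n)) (b : 'cV[R]_m) (i : 'I_n) :
    R :=
  maxval [set x i 0 | x in packing_set A b].

Variables (m1 m2 : nat) (P : 'M[R]_(m1, n)) (Q : 'M[R]_(m2, n)).
Variables (p : 'cV[R]_m1) (q : 'cV[R]_m2).

Let theta := coord_max P p.
Let gamma := coord_max Q q.

Definition LP_feasible (w : 'cV[R]_n) : Prop :=
  [/\ 0 <=m w,
      \sum_i (theta i * w i 0) *: col i P <=m p
    & \sum_i (gamma i * w i 0) *: col i Q <=m q].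

Definition LP_values : set R :=
  [set \sum_i theta i * gamma i * w i 0 | w in LP_feasible].

Definition z_LP : R := maxval LP_values.

Record RLT_feasible (x y : 'cV[R]_n) (u : 'M[R]_n) : Prop := {
  RLT_P  : \sum_i (theta i * x i 0) *: col i P <=m p;
  RLT_Pu : forall j, \sum_i (theta i * u i j) *: col i P <=m y j 0 *: p;
  RLT_Q  : \sum_i (gamma i * y i 0) *: col i Q <=m q;
  RLT_Qu : forall j, \sum_i (gamma i * u j i) *: col i Q <=m x j 0 *: q;
  RLT_x  : forall i, 0 <= x i 0 <= 1;
  RLT_y  : forall i, 0 <= y i 0 <= 1;
  RLT_uy : forall i j, 0 <= u i j <= y j 0;
  RLT_ux : forall i j, 0 <= u j i <= x j 0 }.

Definition RLT_values : set R :=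
  [set z | exists x y u, RLT_feasible x y u /\
                         z = \sum_i theta i * gamma i * u i i].

Definition z_RLT : R := maxval RLT_values.

End PackingBilinear.

(* Main.v *)
Require Import Defs.
From HB Require Import structures.
From mathcomp Require Import all_boot all_order all_algebra.
From mathcomp Require Import all_classical all_reals all_analysis.

Set Implicit Arguments.
Unset Strict Implicit.
Unset Printing Implicit Defensive.

Import Order.TTheory GRing.Theory Num.Theory.
Import numFieldNormedType.Exports.

Local Open Scope classical_set_scope.
Local Open Scope ring_scope.

(* Rescale the columns of P by theta and those of Q by gamma, so that (LP-PDB)
   optimizes over the intersection of two packing polyhedra. By monotonicity, a
   packing polyhedron contains theta_i e_i, hence its rescaled version contains
   every e_i; conversely its points satisfy w_i <= 1 whenever theta_i > 0, so
   truncating w at 1 does not change its value. For a truncated w, the choice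
   x = y = w and u = diag(w) is feasible for (RLT-PDB); in the other direction
   u_ii <= x_i and u_ii <= y_i make the diagonal of u feasible for (LP-PDB).
   Both programs thus have the same values, and the maximum is attained because
   the truncated points of (LP-PDB) form a compact set. *)

Section MatrixOrder.
Variable R : realType.

Lemma lemx_trans m n (A B C : 'M[R]_(m, n)) : A <=m B -> B <=m C -> A <=m C.
Proof. by move=> AB BC i j; exact: le_trans (AB i j) (BC i j). Qed.

Lemma lemx0P m n (A : 'M[R]_(m, n)) : 0 <=m A <-> forall i j, 0 <= A i j.
Proof. by split=> A0 i j; have := A0 i j; rewrite mxE. Qed.

Lemma lemx_mulmx2l m n k (A : 'M[R]_(m, n)) (B C : 'M[R]_(n, k)) :
  0 <=m A -> B <=m C -> A *m B <=m A *m C.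
Proof.
move=> /lemx0P A0 BC i j; rewrite !mxE.
by apply: ler_sum => l _; exact: ler_wpM2l.
Qed.

Lemma mulmx_ge0 m n k (A : 'M[R]_(m, n)) (B : 'M[R]_(n, k)) :
  0 <=m A -> 0 <=m B -> 0 <=m A *m B.
Proof. by move=> A0 /(lemx_mulmx2l A0); rewrite mulmx0. Qed.

Lemma lemx_scale2l m n (a : R) (A B : 'M[R]_(m, n)) :
  0 <= a -> A <=m B -> a *: A <=m a *: B.
Proof. by move=> a0 AB i j; rewrite !mxE; exact: ler_wpM2l. Qed.

End MatrixOrder.

Section MatrixTopology.
Variable R : realType.

Lemma mx_norm_leP m n (A : 'M[R]_(m, n)) (e : R) : 0 <= e ->
  `|A| <= e <-> forall i j, `|A i j| <= e.
Proof.
move=> e0; rewrite [`|A|]mx_normrE; split=> [/bigmax_leP[_ Ae] i j|Ae].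
  exact: (Ae (i, j)).
by apply: bigmax_le => // -[i j] _; exact: Ae.
Qed.

Lemma vec_mx_continuous m n : continuous (@vec_mx R m n).
Proof.
move=> v B /nbhs_ballP[e e0 eB]; apply/nbhs_ballP; exists e => // w [_ vw].
by apply: eB; split=> // i j; rewrite !mxE; exact: vw.
Qed.

Lemma mx_bounded_closed_compact m n (S : set 'M[R]_(m, n)) :
  bounded_set S -> closed S -> compact S.
Proof.
move=> [M [_ SM]] Scl.
have -> : S = vec_mx @` (vec_mx @^-1` S).
  apply/seteqP; split=> [A SA|_ [v Sv <-] //].
  by exists (mxvec A); rewrite /= mxvecK.
apply: continuous_compact; first exact/continuous_subspaceT/vec_mx_continuous.
apply: bounded_closed_compact; last first.
  by apply: preimage_closed => // v _; exact: vec_mx_continuous.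
exists (Num.max M 0); split=> [|e]; first exact: num_real.
rewrite gt_max => /andP[Me e0] v /(SM _ Me) /mx_norm_leP ve.
apply/mx_norm_leP => [|i]; first exact: ltW.
case/mxvec_indexP => j k; rewrite ord1 -(vec_mxK v) mxvecE.
exact/ve/ltW.
Qed.

Lemma closed_lemx (T : topologicalType) m n (f g : T -> 'M[R]_(m, n)) :
    (forall i j, continuous (fun t => f t i j)) ->
    (forall i j, continuous (fun t => g t i j)) ->
  closed [set t | f t <=m g t].
Proof.
move=> cf cg.
have -> : [set t | f t <=m g t] =
    \bigcap_i \bigcap_j ((fun t => g t i j - f t i j) @^-1` [set r | 0 <= r]).
  apply/seteqP; split=> t fg i => [_ j _|j]; first by rewrite /= subr_ge0.
  by have := fg i I j I; rewrite /= subr_ge0.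
apply: closed_bigI => i _; apply: closed_bigI => j _.
apply: preimage_closed => [t _|]; last exact: closed_ge.
by apply: cvgB; [exact: cg | exact: cf].
Qed.

Lemma linear_form_continuous n (c : 'I_n -> R) :
  continuous (fun w : 'cV[R]_n => \sum_i c i * w i 0).
Proof.
apply: (@continuous_big _ _ +%R 0 xpredT) => [|i _ w].
  exact: add_continuous.
by apply: continuousM; [exact: cst_continuous | exact: coord_continuous].
Qed.

Lemma compact_is_max (T : topologicalType) (f : T -> R) (S : set T) :
    S !=set0 -> compact S -> continuous f ->
  is_max (f @` S) (maxval (f @` S)).
Proof.
move=> S0 Sco cf; apply: xgetPex.
have [t /set_mem St tmax] :=
  compact_EVT_max S0 Sco (continuous_subspaceT cf).
by exists (f t); split=> [|_ [s Ss <-]]; [exists t | exact/tmax/mem_set].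
Qed.

End MatrixTopology.

Section PackingSet.
Variables (R : realType) (m n : nat) (A : 'M[R]_(m, n)) (b : 'cV[R]_m).

Lemma closed_packing_set : closed (packing_set A b).
Proof.
apply: closedI; apply: closed_lemx => i j.
- exact: cst_continuous.
- exact: coord_continuous.
- have -> : (fun w : 'cV[R]_n => (A *m w) i j) =
      (fun w => \sum_k A i k * w k 0).
    by apply/funext => w; rewrite ord1 mxE.
  exact: linear_form_continuous.
- exact: cst_continuous.
Qed.

Lemma packing_set0 : 0 <=m b -> packing_set A b 0.
Proof. by move=> b0; split; [move=> i j | rewrite mulmx0]. Qed.

Lemma packing_set_lemx (v w : 'cV[R]_n) : 0 <=m A ->
  0 <=m v -> v <=m w -> packing_set A b w -> packing_set A b v.
Proof.
move=> A0 v0 vw [_ Aw]; split=> //.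
exact: lemx_trans (lemx_mulmx2l A0 vw) Aw.
Qed.

End PackingSet.

Section CoordMax.
Variables (R : realType) (m n : nat) (A : 'M[R]_(m, n)) (b : 'cV[R]_m).
Hypotheses (A_ge0 : 0 <=m A) (b_ge0 : 0 <=m b).
Hypothesis A_bounded : bounded_set (packing_set A b).

Lemma coord_max_is_max i :
  is_max [set x i 0 | x in packing_set A b] (coord_max A b i).
Proof.
apply: compact_is_max; last exact: coord_continuous.
  by exists 0; exact: packing_set0.
exact: mx_bounded_closed_compact A_bounded (@closed_packing_set _ _ _ A b).
Qed.

Lemma packing_set_le_coord_max x i :
  packing_set A b x -> x i 0 <= coord_max A b i.
Proof. by move=> Ax; have [_] := coord_max_is_max i; apply; exists x. Qed.

Lemma coord_max_ge0 i : 0 <= coord_max A b i.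
Proof.
by have := packing_set_le_coord_max i (packing_set0 A b_ge0); rewrite mxE.
Qed.

Lemma packing_set_coord_max_delta i :
  packing_set A b (coord_max A b i *: delta_mx i 0).
Proof.
have [[x Ax xi] _] := coord_max_is_max i.
have [/lemx0P x0 _] := Ax.
apply: packing_set_lemx Ax => // [|k j].
  by apply/lemx0P => k j; rewrite !mxE mulr_ge0 ?coord_max_ge0.
rewrite !mxE ord1 eqxx andbT -xi.
by have [->|_] := eqVneq k i; rewrite ?mulr1 ?mulr0.
Qed.

Definition coord_max_mx : 'M[R]_n := diag_mx (\row_i coord_max A b i).

Definition rescaled_mx : 'M[R]_(m, n) := A *m coord_max_mx.

Lemma coord_max_mx_ge0 : 0 <=m coord_max_mx.
Proof. by apply/lemx0P => i j; rewrite !mxE mulrn_wge0 ?coord_max_ge0. Qed.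

Lemma rescaled_mx_ge0 : 0 <=m rescaled_mx.
Proof. exact: mulmx_ge0 A_ge0 coord_max_mx_ge0. Qed.

Lemma sum_coord_max_col (t : 'I_n -> R) :
  \sum_i (coord_max A b i * t i) *: col i A = rescaled_mx *m \col_i t i.
Proof.
rewrite -mulmxA mul_diag_mx; apply/matrixP => k j; rewrite summxE mxE.
by apply: eq_bigr => i _; rewrite !mxE mulrC.
Qed.

Lemma packing_set_rescaled_col (s t : 'I_n -> R) :
    (forall i, 0 <= s i <= t i) ->
    \sum_i (coord_max A b i * t i) *: col i A <=m b ->
  packing_set rescaled_mx b (\col_i s i).
Proof.
move=> st; rewrite sum_coord_max_col => At.
split; first by apply/lemx0P => i j; rewrite mxE; case/andP: (st i).
apply: lemx_trans At; apply: lemx_mulmx2l rescaled_mx_ge0 _ => i j.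
by rewrite !mxE; case/andP: (st i).
Qed.

Lemma packing_set_rescaled_delta i : packing_set rescaled_mx b (delta_mx i 0).
Proof.
split; first by apply/lemx0P => k j; rewrite mxE.
have [_] := packing_set_coord_max_delta i.
congr (_ <=m b); rewrite -mulmxA mul_diag_mx; congr (_ *m _).
apply/matrixP => k j; rewrite !mxE.
by have [->|_] := eqVneq k i; rewrite ?mulr0.
Qed.

Lemma sum_coord_max_col_diag (w : 'cV[R]_n) j : 0 <=m w ->
  \sum_i (coord_max A b i * diag_mx w^T i j) *: col i A <=m w j 0 *: b.
Proof.
move=> /lemx0P w0; rewrite sum_coord_max_col.
have -> : \col_i diag_mx w^T i j = w j 0 *: delta_mx j 0.
  apply/colP => i; rewrite !mxE andbT.
  by have [->|_] := eqVneq i j; rewrite ?mulr1 ?mulr0.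
rewrite -scalemxAr; apply: lemx_scale2l => //.
by have [] := packing_set_rescaled_delta j.
Qed.

Lemma packing_set_rescaled_le1 w i :
  packing_set rescaled_mx b w -> 0 < coord_max A b i -> w i 0 <= 1.
Proof.
move=> [w0 Aw] theta_gt0; rewrite -(ler_pM2l theta_gt0) mulr1.
have /(packing_set_le_coord_max i) : packing_set A b (coord_max_mx *m w).
  by split; [exact: mulmx_ge0 coord_max_mx_ge0 w0 | rewrite mulmxA].
by rewrite mul_diag_mx !mxE.
Qed.

End CoordMax.

Section LinearPrograms.
Variables (R : realType) (n m1 m2 : nat).
Variables (P : 'M[R]_(m1, n)) (Q : 'M[R]_(m2, n)).
Variables (p : 'cV[R]_m1) (q : 'cV[R]_m2).
Hypotheses (P_ge0 : 0 <=m P) (Q_ge0 : 0 <=m Q).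
Hypotheses (p_ge0 : 0 <=m p) (q_ge0 : 0 <=m q).
Hypotheses (X_bounded : bounded_set (packing_set P p)).
Hypotheses (Y_bounded : bounded_set (packing_set Q q)).

Definition LP_objective (w : 'cV[R]_n) : R :=
  \sum_i coord_max P p i * coord_max Q q i * w i 0.

Definition unit_box : set 'cV[R]_n :=
  [set w | 0 <=m w /\ w <=m const_mx 1].

Lemma unit_box_compact : compact unit_box.
Proof.
apply: mx_bounded_closed_compact.
  exists 1; split=> // e e1 w [/lemx0P w0 w1].
  apply/mx_norm_leP => [|i j]; first exact/ltW/(lt_trans ltr01 e1).
  rewrite ger0_norm //; apply/ltW/(le_lt_trans _ e1).
  by have := w1 i j; rewrite mxE.
apply: closedI; apply: closed_lemx => i j;
  by [exact: cst_continuous | exact: coord_continuous].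
Qed.

Lemma LP_feasibleE : LP_feasible P Q p q =
  packing_set (rescaled_mx P p) p `&` packing_set (rescaled_mx Q q) q.
Proof.
apply/seteqP; split=> w; rewrite /LP_feasible /= !sum_coord_max_col;
  have -> : \col_i w i 0 = w by apply/colP => i; rewrite mxE.
  by move=> [w0 Pw Qw].
by move=> [[w0 Pw] [_ Qw]].
Qed.

Lemma LP_feasible_lemx v w : 0 <=m v -> v <=m w ->
  LP_feasible P Q p q w -> LP_feasible P Q p q v.
Proof.
move=> v0 vw; rewrite LP_feasibleE => -[Pw Qw].
by split; [apply: packing_set_lemx Pw | apply: packing_set_lemx Qw] => //;
  exact: rescaled_mx_ge0.
Qed.

Lemma LP_feasible_truncation w : LP_feasible P Q p q w ->
  exists2 v, (LP_feasible P Q p q `&` unit_box) v &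
    LP_objective v = LP_objective w.
Proof.
move=> LPw; have [w0 _ _] := LPw; have w_ge0 := (lemx0P _).1 w0.
pose v : 'cV[R]_n := \col_i Num.min (w i 0) 1.
have v0 : 0 <=m v by apply/lemx0P => i j; rewrite mxE le_min w_ge0 ler01.
exists v; first split.
- apply: LP_feasible_lemx v0 _ LPw => i j.
  by rewrite ord1 mxE ge_min lexx.
- by split=> // i j; rewrite !mxE ge_min lexx orbT.
apply: eq_bigr => i _; rewrite mxE.
have := coord_max_ge0 p_ge0 X_bounded i.
rewrite le_eqVlt => /predU1P[<-|theta_gt0]; first by rewrite !mul0r.
rewrite min_l //; move: LPw; rewrite LP_feasibleE => -[Pw _].
exact: packing_set_rescaled_le1 Pw theta_gt0.
Qed.

Lemma LP_values_unit_box :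
  LP_values P Q p q = LP_objective @` (LP_feasible P Q p q `&` unit_box).
Proof.
apply/seteqP; split=> _ [w LPw <-]; last by exists w => //; case: LPw.
by have [v LPv vw] := LP_feasible_truncation LPw; exists v.
Qed.

Lemma LP_values_is_max : is_max (LP_values P Q p q) (z_LP P Q p q).
Proof.
rewrite /z_LP LP_values_unit_box; apply: compact_is_max.
- exists 0; rewrite LP_feasibleE.
  split; first by split; exact: packing_set0.
  by split=> i j; rewrite !mxE.
- rewrite LP_feasibleE setIC; apply: compact_closedI unit_box_compact _.
  by apply: closedI; exact: closed_packing_set.
- exact: linear_form_continuous.
Qed.

Lemma RLT_feasible_LP x y u : RLT_feasible P Q p q x y u ->
  LP_feasible P Q p q (\col_i u i i).
Proof.
move=> [Px _ Qy _ _ _ uy ux]; rewrite LP_feasibleE; split.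
  exact: packing_set_rescaled_col Px.
exact: packing_set_rescaled_col Qy.
Qed.

Lemma LP_feasible_RLT w : LP_feasible P Q p q w -> unit_box w ->
  RLT_feasible P Q p q w w (diag_mx w^T).
Proof.
move=> [w0 Pw Qw] [_ w1]; have w_ge0 := (lemx0P _).1 w0.
have uC i j : diag_mx w^T i j = diag_mx w^T j i.
  by rewrite -[in LHS]tr_diag_mx mxE.
have w01 i : 0 <= w i 0 <= 1.
  by rewrite w_ge0; have := w1 i 0; rewrite mxE.
have u01 i j : 0 <= diag_mx w^T i j <= w j 0.
  by rewrite !mxE; have [->|_] := eqVneq i j; rewrite !w_ge0 ?lexx.
split=> // [j|j|i j]; last by rewrite uC.
  exact: sum_coord_max_col_diag.
under eq_bigr => i _ do rewrite uC.
exact: sum_coord_max_col_diag.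
Qed.

Lemma RLT_valuesE : RLT_values P Q p q = LP_values P Q p q.
Proof.
apply/seteqP; split=> z.
  move=> [x [y [u [/RLT_feasible_LP LPu ->]]]].
  by exists (\col_i u i i) => //; apply: eq_bigr => i _; rewrite mxE.
rewrite LP_values_unit_box => -[w [LPw w01] <-].
exists w, w, (diag_mx w^T); split; first exact: LP_feasible_RLT.
by apply: eq_bigr => i _; rewrite !mxE eqxx.
Qed.

End LinearPrograms.

Theorem mainTheorem5 (R : realType) (n m1 m2 : nat)
    (P : 'M[R]_(m1, n)) (Q : 'M[R]_(m2, n))
    (p : 'cV[R]_m1) (q : 'cV[R]_m2)
    (P_ge0 : 0 <=m P) (Q_ge0 : 0 <=m Q) (p_ge0 : 0 <=m p) (q_ge0 : 0 <=m q)
    (X_bounded : bounded_set (packing_set P p))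
    (Y_bounded : bounded_set (packing_set Q q)) :
  [/\ is_max (RLT_values P Q p q) (z_RLT P Q p q),
      is_max (LP_values P Q p q) (z_LP P Q p q)
    & z_RLT P Q p q = z_LP P Q p q].
Proof.
have LP_max : is_max (LP_values P Q p q) (z_LP P Q p q).
  exact: LP_values_is_max.
by rewrite /z_RLT RLT_valuesE.
Qed.
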